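(* For all integers $m\ge 0$ and $k\ge 1$ and all $x\in\mathbb{C}$, $$\sum_{n=0}^{m}\widehat{C}_n^{(k)}(x)\,S_2(m,n)=\sum_{n=0}^{m}S_2(n+k,k)\frac{\binom{m}{n}}{\binom{n+k}{n}}(x-k)^{m-n}.$$
   Context: $(x)_n = x(x-1)\cdots(x-n+1)$ denotes the falling factorial, with $(x)_0=1$. For integers $k\ge1$, $n\ge0$, the higher-order Cauchy polynomials of the second kind (of order $k$) are $$\widehat{C}_n^{(k)}(x)=\int_0^1\cdots\int_0^1 (x-(x_1+\cdots+x_k))_n\,dx_1\cdots dx_k.$$ $S_2(l,n)$ are the Stirling numbers of the second kind, defined by $(e^t-1)^n=n!\sum_{l=n}^\infty S_2(l,n)\frac{t^l}{l!}$. Convention: $0^0=1$. *)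

(* Defs.v *)
From Stdlib Require Import Reals Lra Lia List Factorial.
From Coquelicot Require Import Coquelicot.

Open Scope R_scope.

(* (x)_n = x (x-1) ... (x-n+1) *)
Fixpoint falling (x : C) (n : nat) : C :=
  match n with
  | O => RtoC 1
  | S n' => Cmult (falling x n') (Cminus x (RtoC (INR n')))
  end.

(* Iterated integral of a complex-valued function over the unit cube [0,1]^k;
   a point of the cube is the list of its k coordinates. *)
Fixpoint iterated_RInt01 (k : nat) (f : list R -> C) : C :=
  match k with
  | O => f nil
  | S k' =>
      RInt (V := C_R_CompleteNormedModule)
        (fun u => iterated_RInt01 k' (fun l => f (cons u l))) 0 1
  end.

Definition list_sum_R (l : list R) : R := fold_right Rplus 0 l.

Definition cauchy2 (k n : nat) (x : C) : C :=
  iterated_RInt01 k (fun l => falling (Cminus x (RtoC (list_sum_R l))) n).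

(* Coefficients of the formal power series e^t - 1. *)
Definition expm1_coef (l : nat) : R :=
  match l with O => 0 | S _ => / INR (fact l) end.

(* Coefficients of the n-th power of a formal power series, for the Cauchy
   product. *)
Fixpoint PS_pow (a : nat -> R) (n : nat) : nat -> R :=
  match n with
  | O => fun l => match l with O => 1 | S _ => 0 end
  | S n' => PS_mult a (PS_pow a n')
  end.

(* S_2(l,n), read off from (e^t-1)^n = n! sum_l S_2(l,n) t^l / l!. *)
Definition stirling2 (l n : nat) : R :=
  INR (fact l) / INR (fact n) * PS_pow expm1_coef n l.

Lemma is_pseries_everywhere_CV_radius (a : nat -> R) :
  (forall x, ex_pseries a x) -> CV_radius a = p_infty.
Proof.
intros H.
destruct (CV_radius a) as [r| |] eqn:E; [| reflexivity |].
- exfalso.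
  assert (Hx : Rbar_lt (CV_radius a) (Rabs (Rabs r + 1))).
  { rewrite E; simpl. rewrite (Rabs_pos_eq (Rabs r + 1)).
    - pose proof (Rle_abs r); lra.
    - pose proof (Rabs_pos r); lra. }
  apply (CV_disk_outside a _ Hx).
  apply ex_series_lim_0.
  apply ex_pseries_R. apply H.
- exfalso. pose proof (CV_radius_ge_0 a) as H0. rewrite E in H0. exact H0.
Qed.

Lemma is_pseries_expm1 (t : R) : is_pseries expm1_coef t (exp t - 1).
Proof.
apply is_pseries_R.
pose proof (proj1 (is_pseries_R _ _ _) (is_exp_Reals t)) as H.
apply (is_series_decr_1 (K := R_AbsRing) (V := R_NormedModule)).
apply (is_series_incr_1 (K := R_AbsRing) (V := R_NormedModule)
  (fun n => / INR (fact n) * t ^ n)).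
match goal with |- is_series _ ?v => replace v with (exp t) end.
2:{ unfold plus, opp; simpl; field. }
exact H.
Qed.

Lemma is_pseries_PS_pow_expm1 (n : nat) (t : R) :
  is_pseries (PS_pow expm1_coef n) t ((exp t - 1) ^ n).
Proof.
revert t; induction n as [|n IH]; intros t.
- simpl. apply is_pseries_R.
  apply (is_series_decr_1 (K := R_AbsRing) (V := R_NormedModule)).
  match goal with |- is_series _ ?v => replace v with 0 end.
  2:{ unfold plus, opp; simpl; ring. }
  apply is_series_ext with (fun _ => 0).
  + intros; symmetry; apply Rmult_0_l.
  + apply is_series_Reals. intros e He. exists 0%nat. intros m _.
    rewrite sum_eq_R0; auto. unfold Rdist. rewrite Rminus_0_r, Rabs_R0. exact He.
- simpl. apply is_pseries_mult.
  + apply is_pseries_expm1.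
  + apply IH.
  + rewrite is_pseries_everywhere_CV_radius; [exact I|].
    intros y; eexists; apply is_pseries_expm1.
  + rewrite is_pseries_everywhere_CV_radius; [exact I|].
    intros y; eexists; apply IH.
Qed.

Lemma stirling2_gf (n : nat) (t : R) :
  is_series (fun l => stirling2 l n * (t ^ l / INR (fact l)))
    ((exp t - 1) ^ n / INR (fact n)).
Proof.
apply is_series_ext with
  (fun l => / INR (fact n) * (PS_pow expm1_coef n l * t ^ l)).
- intros l. unfold stirling2.
  match goal with |- ?a = ?b => change (@eq R a b) end.
  field; split; apply INR_fact_neq_0.
- replace ((exp t - 1) ^ n / INR (fact n))
    with (/ INR (fact n) * (exp t - 1) ^ n) by (unfold Rdiv; ring).
  apply (is_series_scal (K := R_AbsRing) (V := R_NormedModule)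
    (/ INR (fact n)) (fun l => PS_pow expm1_coef n l * t ^ l)).
  apply is_pseries_R, is_pseries_PS_pow_expm1.
Qed.

Lemma stirling2_eq0 (l n : nat) : (l < n)%nat -> stirling2 l n = 0.
Proof.
intros H. unfold stirling2.
enough (E : PS_pow expm1_coef n l = 0) by (rewrite E; ring).
revert l H; induction n as [|n IH]; intros l H; [lia|].
simpl. unfold PS_mult. apply sum_eq_R0. intros [|j] Hj.
- simpl; ring.
- rewrite IH; [ring | lia].
Qed.

(* Main.v *)
Require Import Defs.
From Stdlib Require Import Reals Lra Lia List Factorial.
From Coquelicot Require Import Coquelicot.

(** Stirling numbers of the second kind express powers in falling factorials:
    y^m is the sum over n of S_2(m,n) (y)_n ([sum_falling_stirling2]). Taking
    y = x - (x_1 + ... + x_k) and integrating over the cube, the left-hand side is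
    the integral of (x - (x_1 + ... + x_k))^m.

    For that integral, replace every x_i by 1 - x_i. The integrand becomes
    (x - k + x_1 + ... + x_k)^m, whose exponential generating function in t is
    e^((x-k)t) times the product of the e^(x_i t); each e^(x_i t) integrates to
    (e^t - 1)/t, so the result is m! times the coefficient of t^m in
    e^((x-k)t) ((e^t - 1)/t)^k ([is_iterated_RInt01_pow]). The coefficient of t^n in
    ((e^t - 1)/t)^k is that of t^(n+k) in (e^t - 1)^k, namely
    k! S_2(n+k,k) / (n+k)!, and the factorials assemble into the quotient of
    binomials ([PS_pow_expm1_shift], [stirling2_binomial_ratio]).

    The generating functions are handled as coefficient sequences under the Cauchy
    product [conv]; formal differentiation and its Leibniz rule give both the
    addition theorem of the exponential and the Stirling recurrence. *)

Local Open Scope C_scope.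

Definition Csum (a : nat -> C) (n : nat) : C := sum_n a n.

(** The ring tactic reads its carrier off the type of the terms, and that of a sum
    over C is a projection of the canonical monoid structure rather than C itself. *)
Ltac cring :=
  change (@sum_n C_AbelianMonoid) with Csum;
  match goal with |- ?a = ?b => change (@eq C a b); ring end.

(** * Finite sums and Cauchy products of complex sequences *)

Lemma Csum_Sn (a : nat -> C) (n : nat) : sum_n a (S n) = sum_n a n + a (S n).
Proof. exact (sum_Sn a n). Qed.

Lemma Csum_head (a : nat -> C) (n : nat) :
  sum_n a (S n) = a O + sum_n (fun i => a (S i)) n.
Proof.
induction n as [|n IH].
- now rewrite Csum_Sn, !sum_O.
- rewrite Csum_Sn, IH, (Csum_Sn (fun i => a (S i))); cring.
Qed.

Lemma Csum_scal (c : C) (a : nat -> C) (n : nat) :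
  sum_n (fun i => c * a i) n = c * sum_n a n.
Proof. exact (sum_n_mult_l (K := C_Ring) c a n). Qed.

Lemma Csum_plus (a b : nat -> C) (n : nat) :
  sum_n (fun i => a i + b i) n = sum_n a n + sum_n b n.
Proof. exact (sum_n_plus a b n). Qed.

Definition conv (a b : nat -> C) (n : nat) : C :=
  sum_n (fun i => a i * b (n - i)%nat) n.

Lemma conv_ext (a a' b b' : nat -> C) (n : nat) :
  (forall i, a i = a' i) -> (forall i, b i = b' i) -> conv a b n = conv a' b' n.
Proof.
intros Ha Hb; apply sum_n_ext; intros i; now rewrite Ha, Hb.
Qed.

Lemma conv_0 (a b : nat -> C) : conv a b O = a O * b O.
Proof. unfold conv; now rewrite sum_O. Qed.

Lemma conv_S_head (a b : nat -> C) (n : nat) :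
  conv a b (S n) = a O * b (S n) + conv (fun i => a (S i)) b n.
Proof. unfold conv; now rewrite Csum_head. Qed.

Lemma conv_S_last (a b : nat -> C) (n : nat) :
  conv a b (S n) = conv a (fun i => b (S i)) n + a (S n) * b O.
Proof.
unfold conv; rewrite Csum_Sn, Nat.sub_diag; f_equal.
apply sum_n_ext_loc; intros i Hi; now rewrite Nat.sub_succ_l.
Qed.

Lemma conv_comm (a b : nat -> C) (n : nat) : conv a b n = conv b a n.
Proof.
revert a b; induction n as [|n IH]; intros a b.
- rewrite !conv_0; cring.
- rewrite conv_S_head, conv_S_last, IH; cring.
Qed.

Lemma conv_plus_l (a a' b : nat -> C) (n : nat) :
  conv (fun i => a i + a' i) b n = conv a b n + conv a' b n.
Proof.
unfold conv; rewrite <- Csum_plus; apply sum_n_ext; intros i.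
now rewrite Cmult_plus_distr_r.
Qed.

Lemma conv_scal_l (c : C) (a b : nat -> C) (n : nat) :
  conv (fun i => c * a i) b n = c * conv a b n.
Proof.
unfold conv; rewrite <- Csum_scal; apply sum_n_ext; intros i.
now rewrite Cmult_assoc.
Qed.

Lemma conv_plus_r (a b b' : nat -> C) (n : nat) :
  conv a (fun i => b i + b' i) n = conv a b n + conv a b' n.
Proof. now rewrite conv_comm, conv_plus_l, !(conv_comm a). Qed.

Lemma conv_scal_r (c : C) (a b : nat -> C) (n : nat) :
  conv a (fun i => c * b i) n = c * conv a b n.
Proof. now rewrite conv_comm, conv_scal_l, (conv_comm a). Qed.

(** Peeling off the constant term of the leftmost factor keeps the shape of both
    sides, so the induction runs over all sequences at once. *)
Lemma conv_assoc (a b c : nat -> C) (n : nat) :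
  conv (conv a b) c n = conv a (conv b c) n.
Proof.
revert a; induction n as [|n IH]; intros a.
- rewrite !conv_0; cring.
- rewrite (conv_S_head (conv a b)), (conv_S_head a), (conv_S_head b).
  rewrite (conv_ext _ (fun i => a O * b (S i) + conv (fun j => a (S j)) b i) c c);
    [| intros i; apply conv_S_head | reflexivity].
  rewrite conv_plus_l, conv_scal_l, IH.
  rewrite conv_0; cring.
Qed.

Definition deriv (a : nat -> C) (n : nat) : C := INR (S n) * a (S n).

Lemma INR_S_neq0 (n : nat) : RtoC (INR (S n)) <> 0.
Proof. intros H; apply (not_0_INR (S n)); [lia | now apply RtoC_inj]. Qed.

(** Leibniz rule for formal power series: split the weight n + 1 of each product
    a_i b_(n+1-i) as i + (n + 1 - i). *)
Lemma deriv_conv (a b : nat -> C) (n : nat) :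
  deriv (conv a b) n = conv (deriv a) b n + conv a (deriv b) n.
Proof.
assert (Hl : conv (deriv a) b n
  = sum_n (fun i => INR i * (a i * b (S n - i)%nat)) (S n)).
{ rewrite Csum_head; simpl (INR 0); rewrite Cmult_0_l, Cplus_0_l.
  apply sum_n_ext; intros i; unfold deriv; simpl (S n - S i)%nat; cring. }
assert (Hr : conv a (deriv b) n
  = sum_n (fun i => INR (S n - i) * (a i * b (S n - i)%nat)) (S n)).
{ rewrite Csum_Sn, Nat.sub_diag; simpl (INR 0); rewrite Cmult_0_l, Cplus_0_r.
  apply sum_n_ext_loc; intros i Hi; unfold deriv.
  rewrite Nat.sub_succ_l by exact Hi; cring. }
rewrite Hl, Hr, <- Csum_plus; unfold deriv, conv.
rewrite <- Csum_scal; apply sum_n_ext_loc; intros i Hi.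
rewrite (minus_INR _ _ Hi), RtoC_minus; cring.
Qed.

Lemma RtoC_PS_mult (a b : nat -> R) (n : nat) :
  RtoC (PS_mult a b n) = conv (fun i => RtoC (a i)) (fun i => RtoC (b i)) n.
Proof.
assert (H : forall (u : nat -> R) N,
  RtoC (sum_f_R0 u N) = sum_n (fun i => RtoC (u i)) N).
{ intros u N; induction N as [|N IH].
  - now rewrite sum_O.
  - now rewrite Csum_Sn, <- IH, <- RtoC_plus. }
unfold PS_mult, conv; rewrite H.
apply sum_n_ext; intros i; apply RtoC_mult.
Qed.

(** * Divided powers *)

(** Coefficients of the exponential series e^(yt). *)
Definition divpow (y : C) (j : nat) : C := RtoC (/ INR (fact j)) * Cpow y j.

Lemma deriv_divpow (y : C) (j : nat) : deriv (divpow y) j = y * divpow y j.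
Proof.
unfold deriv, divpow.
replace (Cpow y (S j)) with (y * Cpow y j) by reflexivity.
replace (RtoC (/ INR (fact j))) with (INR (S j) * RtoC (/ INR (fact (S j)))).
- ring.
- rewrite <- RtoC_mult; f_equal.
  rewrite fact_simpl, mult_INR; field; split.
  + apply INR_fact_neq_0.
  + apply not_0_INR; lia.
Qed.

Lemma divpow_0 (y : C) : divpow y O = 1.
Proof. unfold divpow; simpl; rewrite Rinv_1; ring. Qed.

(** The binomial theorem, as e^(at) e^(bt) = e^((a+b)t): both sides solve
    f' = (a + b) f with f(0) = 1. *)
Lemma divpow_plus (a b : C) (n : nat) :
  divpow (a + b) n = conv (divpow a) (divpow b) n.
Proof.
induction n as [|n IH].
- simpl; rewrite conv_0, !divpow_0; simpl; ring.
- assert (H : INR (S n) * divpow (a + b) (S n)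
            = INR (S n) * conv (divpow a) (divpow b) (S n)).
  { change (deriv (divpow (a + b)) n = deriv (conv (divpow a) (divpow b)) n).
    rewrite deriv_conv, deriv_divpow, IH.
    rewrite (conv_ext (deriv (divpow a)) (fun i => a * divpow a i) (divpow b) (divpow b));
      [| apply deriv_divpow | reflexivity].
    rewrite (conv_ext (divpow a) (divpow a) (deriv (divpow b)) (fun i => b * divpow b i));
      [| reflexivity | apply deriv_divpow].
    rewrite conv_scal_l, conv_scal_r; ring. }
  pose proof (INR_S_neq0 n) as Hn.
  replace (divpow (a + b) (S n))
    with (/ INR (S n) * (INR (S n) * divpow (a + b) (S n))) by (field; exact Hn).
  rewrite H; field; exact Hn.
Qed.

(** * Stirling numbers and falling factorials *)

(** The differential equation (w^n)' = n (w^n + w^(n-1)) of w = e^t - 1; at n = 0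
    the factor n absorbs the meaningless exponent. *)
Lemma deriv_PS_pow_expm1 (n l : nat) :
  deriv (fun i => RtoC (PS_pow expm1_coef n i)) l
  = INR n * (PS_pow expm1_coef n l + PS_pow expm1_coef (pred n) l).
Proof.
revert l; induction n as [|n IH]; intros l.
- unfold deriv; simpl (PS_pow _ _ (S l)); simpl (INR 0); ring.
- assert (Hmul : forall i, RtoC (PS_pow expm1_coef (S n) i)
    = conv (fun j => RtoC (expm1_coef j)) (fun j => RtoC (PS_pow expm1_coef n j)) i).
  { intros i; exact (RtoC_PS_mult _ _ i). }
  assert (He : forall i, deriv (fun j => RtoC (expm1_coef j)) i
    = RtoC (expm1_coef i) + RtoC (PS_pow expm1_coef 0 i)).
  { intros i; unfold deriv; rewrite <- RtoC_mult, <- RtoC_plus; f_equal.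
    unfold expm1_coef; rewrite fact_simpl, mult_INR.
    destruct i as [|i]; simpl PS_pow.
    - simpl; field.
    - field; split; [apply INR_fact_neq_0 | apply not_0_INR; lia]. }
  assert (H1 : conv (fun j => RtoC (PS_pow expm1_coef 0 j))
                 (fun j => RtoC (PS_pow expm1_coef n j)) l
               = PS_pow expm1_coef n l).
  { destruct l as [|l].
    - rewrite conv_0; simpl; ring.
    - rewrite conv_S_head; simpl (PS_pow _ 0 _).
      rewrite (conv_ext _ (fun i => 0 * 0) _ (fun j => RtoC (PS_pow expm1_coef n j)));
        [| intros; simpl; ring | reflexivity].
      rewrite conv_scal_l; ring. }
  transitivity (deriv (conv (fun j => RtoC (expm1_coef j))
                            (fun j => RtoC (PS_pow expm1_coef n j))) l).
  { unfold deriv; now rewrite Hmul. }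
  rewrite deriv_conv.
  rewrite (conv_ext _ _ _ _ l He (fun i => eq_refl)), conv_plus_l, H1, <- Hmul.
  rewrite (conv_ext _ _ _ _ l (fun i => eq_refl) IH).
  rewrite conv_scal_r, conv_plus_r, <- Hmul, S_INR, RtoC_plus.
  destruct n as [|n].
  + simpl (INR 0); simpl (pred 1); ring.
  + simpl (pred (S n)); simpl (pred (S (S n))).
    replace (conv (fun j => RtoC (expm1_coef j))
               (fun j => RtoC (PS_pow expm1_coef n j)) l)
      with (RtoC (PS_pow expm1_coef (S n) l)) by exact (RtoC_PS_mult _ _ l).
    ring.
Qed.

Lemma stirling2_SS (l n : nat) :
  (stirling2 (S l) (S n) = INR (S n) * stirling2 l (S n) + stirling2 l n)%R.
Proof.
pose proof (deriv_PS_pow_expm1 (S n) l) as H; unfold deriv in H.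
rewrite <- RtoC_plus, <- !RtoC_mult in H; apply RtoC_inj in H; simpl pred in H.
unfold stirling2; rewrite (fact_simpl l), mult_INR.
transitivity (INR (fact l) / INR (fact (S n))
              * (INR (S l) * PS_pow expm1_coef (S n) (S l)))%R.
- field; apply INR_fact_neq_0.
- rewrite H, (fact_simpl n), mult_INR; field; split.
  + apply INR_fact_neq_0.
  + apply not_0_INR; lia.
Qed.

(** Induction on m: multiplying by y turns the falling factorial (y)_n into
    (y)_(n+1) + n (y)_n, which is the Stirling recurrence. *)
Lemma sum_falling_stirling2 (y : C) (m : nat) :
  sum_n (fun n => falling y n * stirling2 m n) m = Cpow y m.
Proof.
induction m as [|m IH].
- rewrite sum_O; unfold stirling2; simpl.
  rewrite <- RtoC_mult; f_equal; field.
- rewrite Csum_head.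
  replace (stirling2 (S m) 0) with 0%R by (unfold stirling2; simpl; ring).
  rewrite Cmult_0_r, Cplus_0_l.
  set (A := fun n => falling y n * (INR n * stirling2 m n)).
  (* The weighted sum may be shifted freely: its terms at 0 and m + 1 vanish. *)
  assert (HA : sum_n (fun n => A (S n)) m = sum_n A m).
  { transitivity (sum_n A (S m)).
    - rewrite Csum_head; unfold A at 2; simpl (INR 0); cring.
    - rewrite Csum_Sn; unfold A at 2.
      rewrite (stirling2_eq0 m (S m)) by lia; cring. }
  transitivity (sum_n (fun n => A (S n)) m
                + sum_n (fun n => falling y (S n) * stirling2 m n) m).
  { rewrite <- Csum_plus; apply sum_n_ext; intros n; unfold A.
    rewrite stirling2_SS, RtoC_plus, RtoC_mult; cring. }
  rewrite HA, <- Csum_plus.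
  replace (Cpow y (S m)) with (y * Cpow y m) by reflexivity.
  rewrite <- IH, <- Csum_scal; apply sum_n_ext; intros n; unfold A.
  simpl falling; cring.
Qed.

(** * Iterated integrals over the cube *)

(** Relational form of the iterated integral: it carries integrability in every
    variable along with the value, so that it is linear. *)
Fixpoint is_iterated_RInt01 (k : nat) (f : list R -> C) (v : C) : Prop :=
  match k with
  | O => f nil = v
  | S k' => exists g : R -> C,
      (forall u, is_iterated_RInt01 k' (fun l => f (u :: l)) (g u)) /\
      is_RInt (V := C_R_CompleteNormedModule) g 0 1 v
  end.

Lemma is_iterated_RInt01_unique (k : nat) (f : list R -> C) (v : C) :
  is_iterated_RInt01 k f v -> iterated_RInt01 k f = v.
Proof.
revert f v; induction k as [|k IH]; intros f v; simpl; [easy|].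
intros [g [Hg Hv]].
apply (is_RInt_unique (V := C_R_CompleteNormedModule)).
eapply is_RInt_ext; [| exact Hv].
intros u _; symmetry; apply IH, Hg.
Qed.

Lemma is_iterated_RInt01_ext (k : nat) (f f' : list R -> C) (v : C) :
  (forall l, f l = f' l) -> is_iterated_RInt01 k f v -> is_iterated_RInt01 k f' v.
Proof.
revert f f' v; induction k as [|k IH]; intros f f' v E; simpl.
- now rewrite E.
- intros [g [Hg Hv]]; exists g; split; [| exact Hv].
  intros u; apply (IH (fun l => f (u :: l))); [intros l; apply E | apply Hg].
Qed.

Lemma is_iterated_RInt01_plus (k : nat) (f f' : list R -> C) (v v' : C) :
  is_iterated_RInt01 k f v -> is_iterated_RInt01 k f' v' ->
  is_iterated_RInt01 k (fun l => f l + f' l) (v + v').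
Proof.
revert f f' v v'; induction k as [|k IH]; intros f f' v v'; simpl.
- now intros -> ->.
- intros [g [Hg Hv]] [g' [Hg' Hv']]; exists (fun u => g u + g' u); split.
  + intros u; now apply IH.
  + exact (is_RInt_plus (V := C_R_CompleteNormedModule) _ _ _ _ _ _ Hv Hv').
Qed.

Lemma is_iterated_RInt01_scal (k : nat) (r : R) (f : list R -> C) (v : C) :
  is_iterated_RInt01 k f v -> is_iterated_RInt01 k (fun l => r * f l) (r * v).
Proof.
revert f v; induction k as [|k IH]; intros f v; simpl.
- now intros ->.
- intros [g [Hg Hv]]; exists (fun u => r * g u); split.
  + intros u; now apply IH.
  + rewrite <- scal_R_Cmult; apply (is_RInt_ext (fun u => scal r (g u))).
    * intros u _; apply scal_R_Cmult.
    * now apply (is_RInt_scal (V := C_R_CompleteNormedModule)).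
Qed.

Lemma is_iterated_RInt01_sum (k m : nat) (f : nat -> list R -> C) (v : nat -> C) :
  (forall n, is_iterated_RInt01 k (f n) (v n)) ->
  is_iterated_RInt01 k (fun l => sum_n (fun n => f n l) m) (sum_n v m).
Proof.
intros H; induction m as [|m IH].
- rewrite sum_O; apply (is_iterated_RInt01_ext k (f O)); [| apply H].
  intros l; now rewrite sum_O.
- rewrite Csum_Sn.
  apply (is_iterated_RInt01_ext k (fun l => sum_n (fun n => f n l) m + f (S m) l)).
  + intros l; now rewrite Csum_Sn.
  + now apply is_iterated_RInt01_plus.
Qed.

Lemma is_RInt_Csum (f : nat -> R -> C) (v : nat -> C) (a b : R) (m : nat) :
  (forall n, (n <= m)%nat ->
     is_RInt (V := C_R_CompleteNormedModule) (f n) a b (v n)) ->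
  is_RInt (V := C_R_CompleteNormedModule)
    (fun u => sum_n (fun n => f n u) m) a b (sum_n v m).
Proof.
intros H; induction m as [|m IH].
- rewrite sum_O; apply (is_RInt_ext (V := C_R_CompleteNormedModule) (f O)).
  + intros u _; now rewrite sum_O.
  + now apply H.
- rewrite Csum_Sn.
  apply (is_RInt_ext (V := C_R_CompleteNormedModule)
           (fun u => sum_n (fun n => f n u) m + f (S m) u)).
  + intros u _; now rewrite Csum_Sn.
  + apply (is_RInt_plus (V := C_R_CompleteNormedModule)).
    * apply IH; intros n Hn; apply H; lia.
    * now apply H.
Qed.

Lemma is_RInt_RtoC_mult (r : R -> R) (a b v : R) (c : C) :
  is_RInt r a b v ->
  is_RInt (V := C_R_CompleteNormedModule) (fun u => r u * c) a b (v * c).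
Proof.
intros H.
replace (v * c) with (scal (V := R_ModuleSpace) (fst c) v,
                      scal (V := R_ModuleSpace) (snd c) v).
- apply (is_RInt_fct_extend_pair (U := R_NormedModule) (V := R_NormedModule)).
  + apply (is_RInt_ext (fun u => scal (fst c) (r u))).
    * intros u _; unfold scal; simpl; unfold mult; simpl; ring.
    * now apply (is_RInt_scal (V := R_NormedModule)).
  + apply (is_RInt_ext (fun u => scal (snd c) (r u))).
    * intros u _; unfold scal; simpl; unfold mult; simpl; ring.
    * now apply (is_RInt_scal (V := R_NormedModule)).
- destruct c as [p q]; unfold Cmult, scal; simpl; unfold mult; simpl.
  f_equal; ring.
Qed.

(** * Moments of the uniform law on the cube *)

(** Coefficients of (e^t - 1) / t, the generating function of the divided moments
    of the uniform law on [0,1]. *)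
Definition expm1_over_t_coef (i : nat) : R := / INR (fact (S i)).

Lemma is_RInt_one_minus_pow (j : nat) :
  is_RInt (fun u => / INR (fact j) * (1 - u) ^ j)%R 0 1 (expm1_over_t_coef j).
Proof.
pose proof (INR_fact_neq_0 j) as Hj.
assert (HS : INR (S j) <> 0%R) by (apply not_0_INR; lia).
replace (expm1_over_t_coef j)
  with (minus (- / INR (fact (S j)) * (1 - 1) ^ S j)%R
              (- / INR (fact (S j)) * (1 - 0) ^ S j)%R).
- apply (is_RInt_derive (V := R_CompleteNormedModule)
           (fun u => - / INR (fact (S j)) * (1 - u) ^ S j)%R).
  + intros u _; auto_derive; [easy|].
    change (fact j + j * fact j)%nat with (S j * fact j)%nat; rewrite mult_INR.
    change (match j with O => 1 | S _ => INR j + 1 end)%R with (INR (S j)).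
    change (1 + - u)%R with (1 - u)%R.
    match goal with |- ?a = ?b => change (@eq R a b) end.
    field; now split.
  + intros u _.
    apply (ex_derive_continuous (fun u => / INR (fact j) * (1 - u) ^ j)%R).
    auto_derive; easy.
- unfold expm1_over_t_coef, minus, plus, opp; simpl plus; simpl opp.
  rewrite Rminus_0_r, pow1, Rminus_diag, pow_i by lia; simpl; ring.
Qed.

(** Writing y - u = (1 - u) + (y - 1) and expanding separates the real variable u
    from the complex parameter. *)
Lemma is_RInt_divpow (y : C) (j : nat) :
  is_RInt (V := C_R_CompleteNormedModule) (fun u => divpow (y - RtoC u) j) 0 1
    (conv (fun i => RtoC (expm1_over_t_coef i)) (divpow (y - 1)) j).
Proof.
apply (is_RInt_ext (V := C_R_CompleteNormedModule)
  (fun u => sum_n (fun i => RtoC (/ INR (fact i) * (1 - u) ^ i)%R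
                            * divpow (y - 1) (j - i)) j)).
- intros u _.
  replace (y - RtoC u) with (RtoC (1 - u) + (y - 1)) by (rewrite RtoC_minus; ring).
  rewrite divpow_plus; apply (sum_n_ext (G := C_AbelianMonoid)).
  intros i; unfold divpow at 2; now rewrite RtoC_mult, RtoC_pow.
- apply is_RInt_Csum; intros i _; apply is_RInt_RtoC_mult.
  apply is_RInt_one_minus_pow.
Qed.

(** Each integration multiplies the generating function in t of the divided powers
    by (e^t - 1) / t and moves the base point by 1. *)
Lemma is_iterated_RInt01_divpow (k j : nat) (x : C) :
  is_iterated_RInt01 k (fun l => divpow (x - RtoC (list_sum_R l)) j)
    (conv (fun i => RtoC (PS_pow expm1_over_t_coef k i)) (divpow (x - INR k)) j).
Proof.
revert x; induction k as [|k IH]; intros x.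
- simpl; destruct j as [|j].
  + simpl; rewrite conv_0, !divpow_0; simpl; ring.
  + rewrite conv_S_head.
    rewrite (conv_ext _ (fun i => 0 * 0) _ (divpow (x - 0)));
      [| intros; ring | reflexivity].
    rewrite conv_scal_l; ring.
- exists (fun u => conv (fun i => RtoC (PS_pow expm1_over_t_coef k i))
                        (divpow (x - INR k - RtoC u)) j).
  split.
  + intros u.
    replace (x - INR k - RtoC u) with (x - RtoC u - INR k) by ring.
    eapply is_iterated_RInt01_ext; [| apply IH].
    intros l; simpl; rewrite RtoC_plus.
    apply (f_equal (fun z => divpow z j)); ring.
  + replace (conv _ (divpow (x - INR (S k))) j)
      with (conv (fun i => RtoC (PS_pow expm1_over_t_coef k i))
             (conv (fun i => RtoC (expm1_over_t_coef i)) (divpow (x - INR k - 1))) j).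
    * apply is_RInt_Csum; intros i _.
      apply (is_RInt_ext (V := C_R_CompleteNormedModule)
        (fun u => scal (PS_pow expm1_over_t_coef k i)
                       (divpow (x - INR k - RtoC u) (j - i)))).
      -- intros u _; apply scal_R_Cmult.
      -- rewrite <- scal_R_Cmult; apply (is_RInt_scal (V := C_R_CompleteNormedModule)).
         apply is_RInt_divpow.
    * rewrite <- conv_assoc; apply conv_ext; intros i.
      -- rewrite conv_comm; symmetry; exact (RtoC_PS_mult _ _ i).
      -- rewrite S_INR, RtoC_plus.
         apply (f_equal (fun z => divpow z i)); ring.
Qed.

Lemma is_iterated_RInt01_pow (k j : nat) (x : C) :
  is_iterated_RInt01 k (fun l => Cpow (x - RtoC (list_sum_R l)) j)
    (INR (fact j)
     * conv (fun i => RtoC (PS_pow expm1_over_t_coef k i)) (divpow (x - INR k)) j).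
Proof.
eapply is_iterated_RInt01_ext;
  [| apply is_iterated_RInt01_scal, is_iterated_RInt01_divpow].
intros l; unfold divpow; rewrite Cmult_assoc, <- RtoC_mult, Rinv_r.
- apply Cmult_1_l.
- apply INR_fact_neq_0.
Qed.

(** The extra power y^j makes the induction on n close up, since
    (y)_(n+1) y^j = (y)_n y^(j+1) - n (y)_n y^j. *)
Lemma ex_iterated_RInt01_falling_pow (k n j : nat) (x : C) :
  exists v, is_iterated_RInt01 k
    (fun l => falling (x - RtoC (list_sum_R l)) n
              * Cpow (x - RtoC (list_sum_R l)) j) v.
Proof.
revert j; induction n as [|n IH]; intros j.
- eexists; eapply is_iterated_RInt01_ext;
    [| apply (is_iterated_RInt01_pow k j x)].
  intros l; simpl; ring.
- destruct (IH (S j)) as [v Hv]; destruct (IH j) as [w Hw].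
  exists (v + RtoC (- INR n) * w).
  eapply is_iterated_RInt01_ext;
    [| apply is_iterated_RInt01_plus;
       [exact Hv | apply is_iterated_RInt01_scal; exact Hw]].
  intros l; simpl; rewrite RtoC_opp; ring.
Qed.

Lemma is_iterated_RInt01_falling (k n : nat) (x : C) :
  is_iterated_RInt01 k (fun l => falling (x - RtoC (list_sum_R l)) n) (cauchy2 k n x).
Proof.
destruct (ex_iterated_RInt01_falling_pow k n 0 x) as [v Hv].
assert (H : is_iterated_RInt01 k (fun l => falling (x - RtoC (list_sum_R l)) n) v).
{ eapply is_iterated_RInt01_ext; [| exact Hv]; intros l; simpl; ring. }
unfold cauchy2; now rewrite (is_iterated_RInt01_unique _ _ _ H).
Qed.

(** * The power series of (e^t - 1)^k / t^k *)

Lemma PS_mult_shift (a b : nat -> R) (k n : nat) :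
  (forall l, (l < k)%nat -> b l = 0%R) ->
  PS_mult a b (n + k) = PS_mult a (fun i => b (i + k)%nat) n.
Proof.
revert b; induction k as [|k IH]; intros b Hb.
- rewrite Nat.add_0_r; unfold PS_mult; apply sum_eq; intros i _.
  now rewrite Nat.add_0_r.
- rewrite Nat.add_succ_r.
  transitivity (PS_mult a (fun i => b (S i)) (n + k)).
  + unfold PS_mult; rewrite tech5, Nat.sub_diag, (Hb O) by lia.
    rewrite Rmult_0_r, Rplus_0_r; apply sum_eq; intros i Hi.
    now rewrite Nat.sub_succ_l.
  + rewrite IH by (intros l Hl; apply Hb; lia).
    unfold PS_mult; apply sum_eq; intros i _; now rewrite Nat.add_succ_r.
Qed.

Lemma PS_pow_expm1_low (k l : nat) : (l < k)%nat -> PS_pow expm1_coef k l = 0%R.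
Proof.
intros H; pose proof (stirling2_eq0 l k H) as E; unfold stirling2 in E.
apply Rmult_integral in E; destruct E as [E|E]; [exfalso | exact E].
revert E; apply Rmult_integral_contrapositive_currified.
- apply INR_fact_neq_0.
- apply Rinv_neq_0_compat, INR_fact_neq_0.
Qed.

Lemma PS_pow_expm1_shift (k n : nat) :
  PS_pow expm1_coef k (n + k) = PS_pow expm1_over_t_coef k n.
Proof.
revert n; induction k as [|k IH]; intros n.
- now rewrite Nat.add_0_r; simpl.
- simpl PS_pow; rewrite Nat.add_succ_r.
  transitivity (PS_mult expm1_over_t_coef (PS_pow expm1_coef k) (n + k)).
  + unfold PS_mult; rewrite decomp_sum by lia; simpl pred.
    simpl (expm1_coef 0); rewrite Rmult_0_l, Rplus_0_l; reflexivity.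
  + rewrite PS_mult_shift by apply PS_pow_expm1_low.
    unfold PS_mult; apply sum_eq; intros i _; now rewrite IH.
Qed.

Lemma stirling2_binomial_ratio (m n k : nat) :
  (n <= m)%nat ->
  (stirling2 (n + k) k * (Binomial.C m n / Binomial.C (n + k) n)
   = INR (fact m) * (PS_pow expm1_over_t_coef k n * / INR (fact (m - n))))%R.
Proof.
intros Hn; rewrite <- PS_pow_expm1_shift; unfold stirling2, Binomial.C.
replace (n + k - n)%nat with k by lia.
field; repeat split; apply INR_fact_neq_0.
Qed.

Theorem theorem2p8 :
  forall (m k : nat) (x : C), (1 <= k)%nat ->
  sum_n (fun n : nat => Cmult (cauchy2 k n x) (RtoC (stirling2 m n))) m =
  sum_n (fun n : nat =>
    Cmult
      (RtoC (stirling2 (n + k) k * (Binomial.C m n / Binomial.C (n + k) n)))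
      (Cpow (Cminus x (RtoC (INR k))) (m - n))) m.
Proof.
intros m k x _.
transitivity (iterated_RInt01 k (fun l => Cpow (x - RtoC (list_sum_R l)) m)).
- symmetry; apply is_iterated_RInt01_unique.
  eapply is_iterated_RInt01_ext;
    [intros l; apply (sum_falling_stirling2 (x - RtoC (list_sum_R l)) m)|].
  apply is_iterated_RInt01_sum; intros n.
  rewrite Cmult_comm.
  eapply is_iterated_RInt01_ext;
    [| apply is_iterated_RInt01_scal, is_iterated_RInt01_falling].
  intros l; simpl; apply Cmult_comm.
- rewrite (is_iterated_RInt01_unique _ _ _ (is_iterated_RInt01_pow k m x)).
  unfold conv; rewrite <- Csum_scal; apply sum_n_ext_loc; intros n Hn.
  rewrite stirling2_binomial_ratio by exact Hn.
  unfold divpow; rewrite !RtoC_mult; cring.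
Qed.
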